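(* Let $K$ be a field of prime characteristic $p$ and let $L/K$ be a finite field extension. Then: 1. The field extension $L/L^{G(L/K)}_{dif}$ is a B-extension, hence normal. 2. $\mathcal{D}(L/K)\rtimes G(L/K)=\mathcal{D}\big(L/L^{G(L/K)}_{dif}\big)\rtimes G\big(L/L^{G(L/K)}_{dif}\big)=E\big(L/L^{G(L/K)}_{dif}\big)$. 3. $\mathcal{D}(L/K)=\mathcal{D}\big(L/L^{G(L/K)}_{dif}\big)$. 4. $G(L/K)=G\big(L/L^{G(L/K)}_{dif}\big)$.
   Context: For a finite field extension $L/K$: $E(L/K)=\mathrm{End}_K(L)$; $L$ is viewed as a subfield of $E(L/K)$ via multiplication operators. $G(L/K)=\mathrm{Aut}_{K\text{-alg}}(L)\subseteq E(L/K)$ and $L^{G(L/K)}$ is its fixed field. $\mathcal{D}(L/K)=\bigcup_{i\ge0}\mathcal{D}_i\subseteq E(L/K)$ is the algebra of $K$-linear differential operators on $L$, where $\mathcal{D}_0=L$ and $\mathcal{D}_i=\{\delta\in E(L/K)\mid\delta l-l\delta\in\mathcal{D}_{i-1}\text{ for all }l\in L\}$. $L_{dif}=\{l\in L\mid l\delta=\delta l\text{ for all }\delta\in\mathcal{D}(L/K)\}$ and $L^{G(L/K)}_{dif}:=L^{G(L/K)}\cap L_{dif}$. $\mathcal{D}(L/K)\rtimes G(L/K)$ is the $K$-subalgebra of $E(L/K)$ generated by $\mathcal{D}(L/K)$ and $G(L/K)$, which is the skew group algebra $\bigoplus_{g\in G(L/K)}\mathcal{D}(L/K)g$. $L/K$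 is called a B-extension if $E(L/K)=\mathcal{D}(L/K)\rtimes G(L/K)$. The same notation and terminology is used for $L/M$ with $M$ an intermediate field, all objects being viewed inside $E(L/K)$. *)

(* Defs.v *)
From HB Require Import structures.
From mathcomp Require Import all_boot all_order all_algebra all_field.
From mathcomp Require Import boolp classical_sets.

Set Implicit Arguments.
Unset Strict Implicit.
Unset Printing Implicit Defensive.

Import GRing.Theory.
Local Open Scope classical_set_scope.
Local Open Scope ring_scope.

(* A finite extension L/K is [L : fieldExtType K]; an intermediate field is
   [M : {subfield L}], and K itself, seen inside L, is [1%AS].  All the objects
   attached to L/M are sets of K-linear endomorphisms of L, and l : L is viewed
   as the multiplication operator [amull l]. *)
Section Extensions.
Variables (K : fieldType) (L : fieldExtType K).
Implicit Types (M : {subfield L}) (l : L) (f g d : 'End(L)).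

Definition endM M : set 'End(L) :=
  [set f | forall m l, m \in M -> f (m * l) = m * f l].

Fixpoint diffop_order M (i : nat) : set 'End(L) :=
  if i is j.+1 then
    [set d | endM M d /\
       forall l, diffop_order M j ((d \o amull l)%VF - (amull l \o d)%VF)]
  else range (@amull K L).

Definition diffop M : set 'End(L) := \bigcup_i diffop_order M i.

Definition autM M : set 'End(L) := [set g | kAut M {:L} g].

(* Scalars act through multiplication operators; for M = 1 this is the K-algebra
   structure of 'End(L). *)
Definition subalgebra M (A : set 'End(L)) : Prop :=
  [/\ A \1%VF,
      forall f g, A f -> A g -> A (f + g),
      forall m f, m \in M -> A f -> A (amull m \o f)%VF &
      forall f g, A f -> A g -> A (f \o g)%VF].

Definition skewalg M : set 'End(L) :=
  smallest (subalgebra M) (diffop M `|` autM M).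

Definition B_extension M : Prop := endM M = skewalg M.

(* The condition of [normalFieldP] for L over M; [normalField] itself is only
   available when L is already a splitting field over K. *)
Definition normal_extension M : Prop :=
  forall a : L, exists r : seq L, minPoly M a = \prod_(b <- r) ('X - b%:P).

Definition fixG : set L := [set l | forall g, autM 1%AS g -> g l = l].

Definition Ldif : set L :=
  [set l | forall d, diffop 1%AS d -> (amull l \o d)%VF = (d \o amull l)%VF].

Lemma subfield_of_set (P : set L) :
    P 1 -> (forall a x y, P x -> P y -> P (a *: x + y)) ->
    (forall x y, P x -> P y -> P (x * y)) ->
  {A : {subfield L} | forall x, x \in A <-> P x}.
Proof.
move=> P1 Plin Pmul; apply: cid.
have P0 : P 0 by have := Plin (-1) _ _ P1 P1; rewrite scaleN1r addNr.
pose good n := `[< exists2 U : {vspace L}, (forall x, x \in U -> P x) & \dim U = n >].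
have ex_good : exists n, good n.
  exists 0%N; apply/asboolP; exists 0%VS; last exact: dimv0.
  by move=> x; rewrite memv0 => /eqP->.
have good_le n : good n -> (n <= \dim {:L})%N.
  by move=> /asboolP[U _ <-]; apply: dimvS; apply: subvf.
case: (ex_maxnP ex_good good_le) => n /asboolP[U UP dimU] maxU.
have PU x : P x -> x \in U.
  move=> Px.
  have leU : (\dim (<[x]> + U) <= \dim U)%N.
    rewrite dimU; apply: maxU; apply/asboolP; exists (<[x]> + U)%VS => // y.
    move=> /memv_addP[_ /vlineP[a ->] [u Uu ->]].
    by apply: Plin => //; apply: UP.
  have /eqP-> : (U == <[x]> + U)%VS by rewrite eqEdim addvSr leU.
  by apply: (subvP (addvSl _ _)); apply: memv_line.
have aspU : is_aspace U.
  rewrite /is_aspace has_algid1 ?PU //=; apply/prodvP => x y Ux Uy.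
  by apply: PU; apply: Pmul; apply: UP.
by exists (ASpace aspU) => x; split; [apply: UP | apply: PU].
Qed.

Lemma amull_commP l d :
  (amull l \o d)%VF = (d \o amull l)%VF <-> forall x, d (l * x) = l * d x.
Proof.
split=> [/lfunP E x|E]; last by apply/lfunP=> x; rewrite !comp_lfunE !lfunE /= E.
by have := E x; rewrite !comp_lfunE !lfunE.
Qed.

Fact fixG_dif_exists :
  {A : {subfield L} | forall x, x \in A <-> (fixG `&` Ldif) x}.
Proof.
apply: subfield_of_set => [|a x y [Gx Dx] [Gy Dy]|x y [Gx Dx] [Gy Dy]].
- split=> [g|d _]; last by apply/amull_commP => x; rewrite !mul1r.
  by rewrite /autM /= kAutfE => /kHom_monoid_morphism[].
- split=> [g Gg|d Dd]; first by rewrite linearP /= Gx ?Gy.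
  have /amull_commP Ex := Dx d Dd; have /amull_commP Ey := Dy d Dd.
  by apply/amull_commP => z; rewrite !mulrDl -!scalerAl linearP /= Ex Ey.
- split=> [g Gg|d Dd].
    have := Gg; rewrite /autM /= kAutfE => /kHom_monoid_morphism[_ gM].
    by rewrite gM Gx ?Gy.
  have /amull_commP Ex := Dx d Dd; have /amull_commP Ey := Dy d Dd.
  by apply/amull_commP => z; rewrite -!mulrA Ex Ey.
Qed.

Definition fixG_dif : {subfield L} := sval fixG_dif_exists.

Lemma fixG_difP x : x \in fixG_dif <-> (fixG `&` Ldif) x.
Proof. exact: (svalP fixG_dif_exists). Qed.

End Extensions.

Arguments fixG_dif {K} L.

(* Main.v *)
(** By the Jacobson-Bourbaki argument, an algebra [A] of endomorphisms of [L]
    containing the multiplications acts densely, so it is all of [E(L/M)] where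
    [M] is its commutant; for [A] generated by [D(L/K)] and [G(L/K)] the
    commutant is the field fixed by [G(L/K)] and centralised by [D(L/K)].
    For normality, fix [a]: the operators [f |-> f a] and [f |-> b f] on [E(L/M)]
    commute, and every [f] in the algebra is killed by [prod_b (f |-> f a - b f)]
    for a finite list of [b] in [L] (nilpotence on differential operators, [b = g a]
    for an automorphism [g]).  Applied to an [f] vanishing on [1, a, ..., a^(n-2)]
    but not on [a^(n-1)], with [n] the degree of [a] over [M], this forces the
    minimal polynomial of [a] to divide [prod_b (X - b)]. *)
Require Import Defs.
From mathcomp Require Import all_boot all_order all_algebra all_field.
From mathcomp Require Import boolp classical_sets.

Set Implicit Arguments.
Unset Strict Implicit.
Unset Printing Implicit Defensive.

Import GRing.Theory.
Local Open Scope ring_scope.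

(** * Differential operators, automorphisms and the algebra they generate *)

Section Endomorphisms.
Variables (K : fieldType) (L : fieldExtType K).
Implicit Types (M : {subfield L}) (A : set 'End(L)) (f g h d : 'End(L)) (a b : L).

Lemma amullE a x : amull a x = a * x.
Proof. by rewrite lfunE. Qed.

Lemma comp_amullE f a x : (f \o amull a)%VF x = f (a * x).
Proof. by rewrite comp_lfunE amullE. Qed.

Lemma amull_compE f a x : (amull a \o f)%VF x = a * f x.
Proof. by rewrite comp_lfunE amullE. Qed.

Lemma endM1 f : endM 1%AS f.
Proof. by move=> _ x /vlineP[k ->]; rewrite -!scalerAl !mul1r linearZ. Qed.

Lemma subalgebra_endM M : subalgebra M (endM M).
Proof.
split.
- by move=> m x _; rewrite !lfunE.
- by move=> f g fM gM m x mM; rewrite !add_lfunE fM ?gM ?mulrDr.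
- by move=> c f cM fM m x mM; rewrite !amull_compE fM // mulrCA.
- by move=> f g fM gM m x mM; rewrite !comp_lfunE gM ?fM.
Qed.

Lemma amull_diffop M a : diffop M (amull a).
Proof. by exists 0%N => //; exists a. Qed.

Lemma autM_fix M g m : autM M g -> m \in M -> g m = m.
Proof. by rewrite /autM /= kAutfE => /kHomP_tmp[gM _] /gM. Qed.

Lemma autM_mul M g x y : autM M g -> g (x * y) = g x * g y.
Proof. by rewrite /autM /= kAutfE => /kHomP_tmp[_ ->]; rewrite ?memvf. Qed.

Lemma diffop_endM M d : diffop M d -> endM M d.
Proof.
case=> -[|i] _; last by case.
by case=> a _ <- m x _; rewrite !amullE mulrCA.
Qed.

Lemma autM_endM M g : autM M g -> endM M g.
Proof. by move=> gG m x mM; rewrite (autM_mul _ _ gG) (autM_fix gG). Qed.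

Lemma subalgebra_skewalg M : subalgebra M (skewalg M).
Proof.
split.
- by move=> A [[]].
- by move=> f g fA gA A AP; have [[_ + _ _] _] := AP; apply; [apply: fA | apply: gA].
- by move=> m f mM fA A AP; have [[_ _ + _] _] := AP; apply=> //; apply: fA.
- by move=> f g fA gA A AP; have [[_ _ _ +] _] := AP; apply; [apply: fA | apply: gA].
Qed.

Lemma skewalg_diffop M d : diffop M d -> skewalg M d.
Proof. by move=> dD; apply: sub_gen_smallest; left. Qed.

Lemma skewalg_autM M g : autM M g -> skewalg M g.
Proof. by move=> gG; apply: sub_gen_smallest; right. Qed.

Lemma skewalg_endM M f : skewalg M f -> endM M f.
Proof.
move: f; apply: (@smallest_sub _ _ _ (endM M)); first exact: subalgebra_endM.
by move=> f [/diffop_endM|/autM_endM].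
Qed.

(** The base field enters the orders only through the linearity clause; the commutators are the same
    for [M] and [N]. *)
Lemma diffop_order_sub M N i d : (forall f, diffop M f -> endM N f) ->
  diffop_order M i d -> diffop_order N i d.
Proof.
move=> MN; elim: i d => // i IH d dD; split; last by move=> l; apply: IH; apply: dD.2.
by apply: MN; exists i.+1.
Qed.

Lemma diffop_sub M N : (forall f, diffop M f -> endM N f) ->
  (diffop M `<=` diffop N)%classic.
Proof. by move=> MN d [i iT /(diffop_order_sub MN)]; exists i. Qed.

(* Scalars enter the generated algebra as order-zero differential operators, so
   the base field over which it is generated does not matter. *)
Lemma skewalg_sub M N : diffop M = diffop N -> autM M = autM N ->
  (skewalg M `<=` skewalg N)%classic.
Proof.
move=> eqD eqG; apply: smallest_sub; last by rewrite eqD eqG; apply: sub_gen_smallest.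
have [A1 AD _ AM] := subalgebra_skewalg N; split=> // m f _ fA.
exact: AM (skewalg_diffop (amull_diffop N m)) fA.
Qed.

(** * Density *)

Section Density.
Variables (M : {subfield L}) (A : set 'End(L)).
Hypotheses (Amull : forall a, A (amull a)) (AM : (A `<=` endM M)%classic)
  (AD : forall f g, A f -> A g -> A (f + g))
  (AC : forall f g, A f -> A g -> A (f \o g)%VF)
  (commutantA : forall m, (forall f x, A f -> f (m * x) = m * f x) -> m \in M).

(** Induction on [s]. If every [f] in [A] killing the tail kills the head [y], then [y] gets
    coefficient [0]; otherwise some [b] in [A] kills the tail with [b y = 1], and [b x] is the
    coefficient of [y]. *)
Lemma density (s : seq L) (x : L) :
    (forall f, A f -> (forall i, (i < size s)%N -> f s`_i = 0) -> f x = 0) ->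
  exists2 c : nat -> L, forall i, c i \in M & x = \sum_(i < size s) c i * s`_i.
Proof.
elim: s x => [|y s IH] x annx.
  exists (fun=> 0) => [i|]; first exact: mem0v.
  by have := annx _ (Amull 1); rewrite amullE mul1r big_ord0; apply.
pose ann f := A f /\ forall i, (i < size s)%N -> f s`_i = 0.
have ann_comp f g : A f -> ann g -> ann (f \o g)%VF.
  move=> fA [gA g0]; split; first exact: AC.
  by move=> i /g0; rewrite comp_lfunE => ->; rewrite linear0.
have annD f g : ann f -> ann g -> ann (f + g).
  move=> [fA f0] [gA g0]; split; first exact: AD.
  by move=> i lti; rewrite add_lfunE f0 ?g0 ?addr0.
have annxy f : ann f -> f y = 0 -> f x = 0.
  by move=> [fA f0] fy; apply: annx fA _ => -[_|i /f0].
have [anny|] := pselect (forall f, ann f -> f y = 0).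
  have [|c cM ->] := IH x; first by move=> f fA f0; apply: annxy => //; apply: anny.
  exists (fun i => if i is j.+1 then c j else 0); first by case=> //; apply: mem0v.
  by rewrite big_ord_recl mul0r add0r.
move=> /existsNP[h /not_implyP[ha /eqP hy0]].
have [b ba by1] : exists2 b, ann b & b y = 1.
  exists (amull (h y)^-1%R \o h)%VF; first exact: ann_comp.
  by rewrite amull_compE mulVf.
(* The operator [f - f(y) b] kills the tail and [y], hence [x]. *)
have prop f : ann f -> f x = f y * b x.
  move=> fa; apply/eqP; rewrite -subr_eq0.
  have /annxy : ann (f + (amull (- f y)%R \o b)%VF) by apply: annD => //; apply: ann_comp.
  by rewrite !add_lfunE !amull_compE by1 mulr1 subrr mulNr => ->.
(* For [g] in [A], [g \o b] still kills the tail, so [g (b x) = g 1 * b x]. Taking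
   [g = f \o amull z] shows that [f] commutes with multiplication by [b x]. *)
have bxM : b x \in M.
  apply: commutantA => f z fA.
  have pz g : A g -> g (b x) = g 1 * b x.
    by move=> gA; rewrite -by1 -!comp_lfunE; apply/prop/ann_comp.
  have := pz _ (AC fA (Amull z)); rewrite !comp_amullE mulr1 => fz.
  by rewrite mulrC fz mulrC.
have [|c cM cx] := IH (x - b x * y).
  move=> f fA f0; rewrite linearB /= (AM fA) // (prop f) //.
  by rewrite mulrC subrr.
exists (fun i => if i is j.+1 then c j else b x); first by case.
by rewrite big_ord_recl /= -cx addrC subrK.
Qed.

(** Points are added one at a time: either the values on [s] force the value at the new point [x],
    by [density], or some [h] in [A] vanishing on [s] but not at [x] corrects [g]. *)
Lemma interpolation (s : seq L) f : endM M f ->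
  exists2 g, A g & forall i, (i < size s)%N -> g s`_i = f s`_i.
Proof.
move=> fM; elim/last_ind: s => [|s x [g gA gf]]; first by exists (amull 1).
rewrite size_rcons.
have [annx|] := pselect
  (forall h, A h -> (forall i, (i < size s)%N -> h s`_i = 0) -> h x = 0).
  exists g => // i; rewrite ltnS leq_eqVlt nth_rcons => /predU1P[->|lti]; last by rewrite lti gf.
  rewrite ltnn eqxx; have [c cM ->] := density annx; rewrite !linear_sum.
  by apply: eq_bigr => k _ /=; rewrite (AM gA) ?fM ?gf.
move=> /existsNP[h /not_implyP[hA /not_implyP[h0 /eqP hx]]].
exists (g + (amull ((f x - g x) / h x)%R \o h)%VF); first by apply: AD => //; apply: AC.
move=> i; rewrite ltnS leq_eqVlt nth_rcons add_lfunE amull_compE => /predU1P[->|lti].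
  by rewrite ltnn eqxx divfK // addrC subrK.
by rewrite lti h0 // mulr0 addr0 gf.
Qed.

Lemma endM_sub_dense : (endM M `<=` A)%classic.
Proof.
move=> f fM; have [g gA gf] := interpolation (vbasis {:L}) fM.
suff -> : f = g by [].
apply/lfunP => x; rewrite (coord_vbasis (memvf x)) !linear_sum.
by apply: eq_bigr => i _; rewrite !linearZ /= gf ?size_tuple.
Qed.

(** Otherwise [density] makes the top power an [M]-combination of the lower ones, and [a] is a root
    of a monic polynomial over [M] of degree less than that of [minPoly M a]. *)
Lemma exists_top_power a : exists2 f, A f &
  (forall i, (i < (adjoin_degree M a).-1)%N -> f (a ^+ i) = 0) /\
  f (a ^+ (adjoin_degree M a).-1) != 0.
Proof.
set n := _.-1; apply: contrapT => noF.
have [|c cM /eqP] := @density (mkseq (fun i => a ^+ i) n) (a ^+ n).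
  move=> f fA f0; apply: contrapT => /eqP fn; apply: noF; exists f => //; split=> // i lti.
  by have := f0 i; rewrite size_mkseq nth_mkseq //; apply.
rewrite size_mkseq -subr_eq0; under eq_bigr => i _ do rewrite nth_mkseq //.
pose q := 'X^n - \poly_(i < n) c i.
have sq : size q = n.+1.
  by rewrite size_polyDl ?size_polyXn // size_polyN ltnS size_poly.
have qM : q \is a polyOver M.
  by rewrite rpredB ?rpredX ?polyOverX //; apply/polyOver_poly => i _; apply: cM.
move=> ca; have /(minPoly_dvdp qM)/dvdp_leq : root q a.
  by rewrite /root /q hornerD hornerN hornerXn horner_poly.
rewrite -size_poly_gt0 sq size_minPoly => /(_ isT).
(* The degree is positive, so the truncated predecessor is strictly smaller. *)
by rewrite /n prednK ?ltnn // adjoin_degreeE divn_gt0 ?adim_gt0 ?dimvS ?subv_adjoin.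
Qed.

End Density.

(** * Operators killed by a product of twisted commutators *)

Definition twist a b f : 'End(L) := (f \o amull a)%VF - (amull b \o f)%VF.

Fixpoint killed a (s : seq L) f : Prop :=
  if s is b :: s' then killed a s' (twist a b f) else f = 0.

Lemma twistE a b f x : twist a b f x = f (a * x) - b * f x.
Proof. by rewrite add_lfunE opp_lfunE comp_amullE amull_compE. Qed.

Lemma killed0 a s : killed a s 0.
Proof.
elim: s => //= b s; suff -> : twist a b 0 = 0 by [].
by apply/lfunP => x; rewrite twistE !lfunE /= mulr0 subr0.
Qed.

Lemma killedD a s f g : killed a s f -> killed a s g -> killed a s (f + g).
Proof.
elim: s f g => [|b s IH] f g /=; first by move=> -> ->; rewrite addr0.
move=> kf kg; have := IH _ _ kf kg; congr killed.
by apply/lfunP => x; rewrite [LHS]add_lfunE !twistE !add_lfunE mulrDr opprD addrACA.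
Qed.

Lemma killed_amull_comp a s c f : killed a s f -> killed a s (amull c \o f)%VF.
Proof.
elim: s f => [|b s IH] f /=; first by move=> ->; apply/lfunP => x; rewrite amull_compE !lfunE /= mulr0.
move=> /IH; congr killed.
by apply/lfunP => x; rewrite twistE !amull_compE twistE mulrBr (mulrCA c).
Qed.

Lemma killed_comp_amull a s c f : killed a s f -> killed a s (f \o amull c)%VF.
Proof.
elim: s f => [|b s IH] f /=; first by move=> ->; apply/lfunP => x; rewrite comp_amullE !lfunE.
move=> /IH; congr killed.
by apply/lfunP => x; rewrite twistE !comp_amullE twistE (mulrCA c).
Qed.

(** [twist a b] is a sum of a right and a left multiplication, both of which preserve [killed];
    hence factors can be prepended to the list. *)
Lemma killed_twist a s b f : killed a s f -> killed a s (twist a b f).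
Proof.
move=> kf; have -> : twist a b f = (f \o amull a)%VF + (amull (- b)%R \o f)%VF.
  by apply/lfunP => x; rewrite twistE add_lfunE comp_amullE amull_compE mulNr.
by apply: killedD; [apply: killed_comp_amull | apply: killed_amull_comp].
Qed.

Lemma killed_catr a s t f : killed a t f -> killed a (s ++ t) f.
Proof. by elim: s f => //= b s IH f kf; apply: IH; apply: killed_twist. Qed.

Lemma killed_catl a s t f : killed a s f -> killed a (s ++ t) f.
Proof. by elim: s f => [|b s IH] f /= => [->|/IH//]; apply: killed0. Qed.

(** All [a] are quantified, each with its own list, because for a composite [f \o g] the entries of
    the list for [g] become the points at which [f] is twisted. *)
Definition split_killed f := forall a, exists s, killed a s f.

Lemma split_killedD f g : split_killed f -> split_killed g -> split_killed (f + g).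
Proof.
move=> kf kg a; have [[s sf] [t tg]] := (kf a, kg a).
by exists (s ++ t); apply: killedD; [apply: killed_catl | apply: killed_catr].
Qed.

Lemma split_killed_amull_comp b f : split_killed f -> split_killed (amull b \o f)%VF.
Proof. by move=> kf a; have [s sf] := kf a; exists s; apply: killed_amull_comp. Qed.

Lemma split_killed_comp_amull b f : split_killed f -> split_killed (f \o amull b)%VF.
Proof. by move=> kf a; have [s sf] := kf a; exists s; apply: killed_comp_amull. Qed.

(* Induction on the list killing [g] at [a], then on the list killing [f] at its
   head [c], through
   [f g a - b f g = (f c - b f) g + f (g a - c g)]. *)
Lemma split_killed_comp f g : split_killed f -> split_killed g -> split_killed (f \o g)%VF.
Proof.
move=> + kg a; have [s] := kg a; elim: s g {kg} f => [|c s IHs] g f /= kg kf.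
  by exists [::]; rewrite kg /=; apply/lfunP => x; rewrite comp_lfunE !lfunE /= linear0.
have [t] := kf c; elim: t f kf => [|b t IHt] f kf /= ktf.
  by exists [::]; rewrite ktf /=; apply/lfunP => x; rewrite comp_lfunE !lfunE.
have [|u ku] := IHt _ _ ktf.
  have -> : twist c b f = (f \o amull c)%VF + (amull (- b)%R \o f)%VF.
    by apply/lfunP => x; rewrite twistE add_lfunE comp_amullE amull_compE mulNr.
  apply: split_killedD; first exact: split_killed_comp_amull.
  exact: split_killed_amull_comp.
have [v kv] := IHs _ _ kg kf; exists (b :: u ++ v) => /=.
have -> : twist a b (f \o g)%VF = (twist c b f \o g)%VF + (f \o twist a c g)%VF.
  apply/lfunP => x; rewrite add_lfunE twistE !comp_lfunE !twistE linearB /=.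
  by rewrite [RHS]addrC addrA subrK.
by apply: killedD; [apply: killed_catl | apply: killed_catr].
Qed.

Lemma split_killed_diffop M d : diffop M d -> split_killed d.
Proof.
(* One factor more than the order: [i] commutators with [a] leave a multiplication, and the last one
   kills it. *)
move=> [i _ dD] a; exists (nseq i.+1 a); elim: i d dD => [|i IH] d /=.
  by move=> [l _ <-]; apply/lfunP => x; rewrite twistE !lfunE /= mulrCA subrr.
by move=> [_ /(_ a)/IH].
Qed.

Lemma split_killed_autM M g : autM M g -> split_killed g.
Proof.
move=> gG a; exists [:: g a] => /=; apply/lfunP => x.
by rewrite twistE (autM_mul _ _ gG) subrr lfunE.
Qed.

Lemma split_killed_skewalg M f : skewalg M f -> split_killed f.
Proof.
move: f; apply: (@smallest_sub _ _ _ split_killed); last first.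
  by move=> f [/split_killed_diffop|/split_killed_autM].
have k1 : split_killed \1%VF.
  by move=> a; exists [:: a]; apply/lfunP => x; rewrite twistE !lfunE subrr.
split=> //.
- exact: split_killedD.
- by move=> m f _; apply: split_killed_amull_comp.
- exact: split_killed_comp.
Qed.

(** * Normality *)

(* The action of [q(f |-> f a)] on [f], coefficients of [q] multiplying on the left,
   evaluated at [x]. *)
Definition polyact a f (q : {poly L}) x := \sum_(i < size q) q`_i * f (a ^+ i * x).

Lemma polyact_wide n a f (q : {poly L}) x : (size q <= n)%N ->
  polyact a f q x = \sum_(i < n) q`_i * f (a ^+ i * x).
Proof.
move=> leqn; rewrite /polyact (big_ord_widen _ (fun i => q`_i * f (a ^+ i * x)) leqn) big_mkcond.
by apply: eq_bigr => i _; case: ltnP => // /leq_sizeP->; rewrite ?mul0r.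
Qed.

Lemma polyactD a f (q r : {poly L}) x :
  polyact a f (q + r) x = polyact a f q x + polyact a f r x.
Proof.
pose n := maxn (size q) (size r).
rewrite !(@polyact_wide n) ?leq_maxl ?leq_maxr ?size_polyD // -big_split /=.
by apply: eq_bigr => i _; rewrite coefD mulrDl.
Qed.

Lemma polyactZ a f c (q : {poly L}) x : polyact a f (c *: q) x = c * polyact a f q x.
Proof.
rewrite (@polyact_wide (size q)) ?size_scale_leq // mulr_sumr.
by apply: eq_bigr => i _; rewrite coefZ mulrA.
Qed.

Lemma polyactMX a f (q : {poly L}) x : polyact a f (q * 'X) x = polyact a f q (a * x).
Proof.
rewrite (@polyact_wide (size q).+1) ?big_ord_recl.
  rewrite coefMX /= mul0r add0r; apply: eq_bigr => i _.
  by rewrite coefMX /= exprSr mulrA.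
by apply: leq_trans (size_polyMleq _ _) _; rewrite size_polyX addn2.
Qed.

(** A linear factor acts as one twist, which turns [killed] into the vanishing of a polynomial
    action. *)
Lemma polyact_XsubC a f b (q : {poly L}) x :
  polyact a f (('X - b%:P) * q) x = polyact a (twist a b f) q x.
Proof.
rewrite mulrBl mulrC mul_polyC polyactD polyactMX -scaleNr polyactZ.
rewrite mulr_sumr -big_split; apply: eq_bigr => i _ /=.
by rewrite twistE mulrBr mulNr !(mulrCA b) (mulrCA a).
Qed.

Lemma polyact_killed a s f x : killed a s f ->
  polyact a f (\prod_(b <- s) ('X - b%:P)) x = 0.
Proof.
elim: s f => [|b s IH] f /=; last by rewrite big_cons polyact_XsubC; apply: IH.
by move=> ->; rewrite /polyact big1 // => i _; rewrite lfunE mulr0.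
Qed.

Lemma polyact_polyOver M a f (q : {poly L}) x : endM M f -> q \is a polyOver M ->
  polyact a f q x = f (q.[a] * x).
Proof.
move=> fM /polyOverP qM; rewrite horner_coef mulr_suml linear_sum.
by apply: eq_bigr => i _; rewrite -mulrA /= [RHS]fM ?qM.
Qed.

(** Coefficients of [q] move inside [f], where [q.[a] = 0] appears; those of [r] lie anywhere in [L]
    and stay outside, whence the induction on [r]. *)
Lemma polyact_multiple M a f (q r : {poly L}) x : endM M f -> q \is a polyOver M ->
  root q a -> polyact a f (r * q) x = 0.
Proof.
move=> fM qM /eqP qa; elim/poly_ind: r x => [|r c IH] x.
  by rewrite mul0r /polyact size_poly0 big_ord0.
rewrite mulrDl mulrAC polyactD polyactMX IH mul_polyC polyactZ.
by rewrite (polyact_polyOver _ _ fM) // qa mul0r linear0 mulr0 addr0.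
Qed.

(* The leading term of a nonzero remainder [r] of degree [k] is isolated by
   evaluating at [x = a ^+ (n - 1 - k)]. *)
Lemma minPoly_dvd_killed M a s f : endM M f -> killed a s f ->
    (forall i, (i < (adjoin_degree M a).-1)%N -> f (a ^+ i) = 0) ->
    f (a ^+ (adjoin_degree M a).-1) != 0 ->
  minPoly M a %| \prod_(b <- s) ('X - b%:P).
Proof.
set n := adjoin_degree M a => fM kf f0 fn.
set P := \prod_(b <- s) _; set q := minPoly M a; apply: contraT => ndvd.
pose r := P %% q; have r0 : r != 0 by rewrite /r -/(dvdp q P).
have sr : (size r <= n)%N.
  by rewrite -ltnS -size_minPoly ltn_modp monic_neq0 ?monic_minPoly.
(* Both [P] and its multiple-of-[q] part act as zero, so the remainder does too. *)
have ract x : polyact a f r x = 0.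
  have := polyact_killed x kf; rewrite -/P [P in polyact _ _ P](divp_eq P q) polyactD.
  by rewrite (polyact_multiple _ _ fM) ?minPolyOver ?root_minPoly ?add0r.
have srp : size r = (size r).-1.+1 by rewrite prednK // size_poly_gt0.
have := ract (a ^+ (n.-1 - (size r).-1)); rewrite /polyact srp big_ord_recr /=.
have lekn : ((size r).-1 <= n.-1)%N by rewrite -!subn1 leq_sub2r.
rewrite big1 => [|i _]; last first.
  by rewrite -exprD f0 ?mulr0 // -[X in (_ < X)%N](subnKC lekn) ltn_add2r.
rewrite add0r -exprD subnKC // => /eqP.
by rewrite mulf_eq0 (negPf fn) orbF -lead_coefE lead_coef_eq0 (negPf r0).
Qed.

End Endomorphisms.

(** * The subfield fixed by the automorphisms and centralised by the differential operators *)

Section FixedField.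
Variables (K : fieldType) (L : fieldExtType K).
Local Notation K1 := (1%AS : {subfield L}).
Local Notation M := (fixG_dif L).

(** Elements of [M] commute with all differential operators over [K], which are therefore
    [M]-linear; conversely every element of ['End(L)] is [K]-linear. *)
Lemma diffop_fixG_dif : diffop K1 = diffop M.
Proof.
apply/seteqP; split; apply: diffop_sub => f fD; last exact: endM1.
move=> m x /fixG_difP[_ /(_ f fD)].
by move/amull_commP.
Qed.

Lemma autM_fixG_dif : autM K1 = autM M.
Proof.
apply/seteqP; split=> g gG; have := gG; rewrite /autM /= !kAutfE => /kHomP_tmp[gfix gM];
    apply/kHomP_tmp; split=> // x xM.
  by have /fixG_difP[/(_ g gG)] := xM.
by case/vlineP: xM => k ->; rewrite linearZ /= (autM_fix gG) ?mem1v.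
Qed.

(** This is the commutant hypothesis of [density]; testing on the generators suffices, and
    [g m = m * g 1 = m] for an automorphism [g]. *)
Lemma mem_fixG_dif m :
  (forall f x, skewalg M f -> f (m * x) = m * f x) -> m \in M.
Proof.
move=> comm; apply/fixG_difP; split=> [g gG|d dD].
  rewrite -[m]mulr1 comm; last by apply: skewalg_autM; rewrite -autM_fixG_dif.
  by congr (_ * _); apply: autM_fix gG _; apply: mem1v.
by apply/amull_commP => x; apply: comm; apply: skewalg_diffop; rewrite -diffop_fixG_dif.
Qed.

Lemma skewalg_amull (N : {subfield L}) (a : L) : skewalg N (amull a).
Proof. exact: skewalg_diffop (amull_diffop N a). Qed.

Lemma B_extension_fixG_dif : B_extension M.
Proof.
have [_ AD _ AC] := subalgebra_skewalg M.
apply/seteqP; split; last exact: skewalg_endM.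
exact: endM_sub_dense (@skewalg_amull M) (@skewalg_endM _ _ M) AD AC mem_fixG_dif.
Qed.

Lemma normal_fixG_dif : normal_extension M.
Proof.
have [_ AD _ AC] := subalgebra_skewalg M; move=> a.
have [f fA [f0 fn]] :=
  exists_top_power (@skewalg_amull M) (@skewalg_endM _ _ M) AD AC mem_fixG_dif a.
have [s kf] := split_killed_skewalg fA a.
(* A divisor of a product of linear factors is, up to a unit, a subproduct; being monic,
   [minPoly M a] equals it. *)
have /dvdp_prod_XsubC[m] := minPoly_dvd_killed (skewalg_endM fA) kf f0 fn.
by rewrite eqp_monic ?monic_minPoly ?monic_prod_XsubC // => /eqP ->; exists (mask m s).
Qed.

End FixedField.

Theorem theorem8p1 (p : nat) (K : fieldType) (charKp : p \in [pchar K])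
    (L : fieldExtType K) :
  let K1 : {subfield L} := 1%AS in
  let M : {subfield L} := fixG_dif L in
  [/\ B_extension M /\ normal_extension M,
      skewalg K1 = skewalg M /\ skewalg M = endM M,
      diffop K1 = diffop M &
      autM K1 = autM M].
Proof.
have [eqD eqG] := (diffop_fixG_dif L, autM_fixG_dif L).
split=> //; first by split; [apply: B_extension_fixG_dif | apply: normal_fixG_dif].
split; last by rewrite -B_extension_fixG_dif.
by apply/seteqP; split; apply: skewalg_sub.
Qed.
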